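(* Let $G$ be a $4$-edge-connected graph with an even number of vertices. Then $G$ has a connected odd factor, i.e. a connected spanning subgraph $F$ of $G$ in which $d_F(v)$ is odd for every vertex $v$.
   Context: All graphs are finite and simple. A factor of $G$ is a spanning subgraph of $G$. A graph is odd if every vertex has odd degree. *)

(* Defs.v *)
From mathcomp Require Import all_boot.

Set Implicit Arguments.
Unset Strict Implicit.
Unset Printing Implicit Defensive.

Record sgraph (T : finType) := SGraph {
  adj :> rel T;
  adj_sym : symmetric adj;
  adj_irr : irreflexive adj
}.

Section Graphs.
Variable T : finType.
Implicit Types (G F : sgraph T) (S : {set {set T}}).

(* An edge is the unordered pair of its two (distinct) end vertices. *)
Definition edges G : {set {set T}} := [set [set x; y] | x in T, y in T & G x y].

Definition degree G (v : T) : nat := #|[set w | G v w]|.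

(* The graph without vertices is not connected. *)
Definition connected_graph G : Prop :=
  0 < #|T| /\ forall x y : T, connect G x y.

Definition del_adj G S : rel T := [rel x y | G x y && ([set x; y] \notin S)].

Lemma del_adj_sym G S : symmetric (del_adj G S).
Proof. by move=> x y; rewrite /del_adj /= adj_sym setUC. Qed.

Lemma del_adj_irr G S : irreflexive (del_adj G S).
Proof. by move=> x; rewrite /del_adj /= adj_irr. Qed.

Definition del_edges G S : sgraph T :=
  SGraph (del_adj_sym G S) (del_adj_irr G S).

Definition edge_connected (k : nat) G : Prop :=
  1 < #|T| /\
  forall S, S \subset edges G -> #|S| < k -> connected_graph (del_edges G S).

(* F has the same vertex set T as G, so it is spanning by construction. *)
Definition factor F G : Prop := subrel F G.

Definition odd_graph G : Prop := forall v : T, odd (degree G v).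

End Graphs.

(* Main.v *)
Require Import Defs.
From mathcomp Require Import all_boot zify.

(**
Split the edge set E of G into two classes, each connected and spanning (a weak
form of the tree packing theorem of Nash-Williams and Tutte). One class A
then makes the factor connected, while edges of the other class, toggled along
paths ending at a fixed vertex x0, correct the parity at every other vertex; the
parity at x0 follows from the handshake lemma, as G has even order.

For the splitting, choose A minimising the number of components of A plus
that of E \ A. Call an edge free in a class when it lies on a cycle of that class.
By minimality, a free edge e that is moved to the other class lies on a cycle
there, and the edges of that cycle become free in turn. Let D be the set of edges
that are free in some class of some bipartition reachable by such moves. Moves do
not change which vertices are joined by the D-edges of a class, so in every
reachable bipartition each class joins the ends of every edge of D using D
alone. All remaining edges are bridges of their class, hence if (V, D) has m
components then |E \ D| <= 2 (m - 1). If m > 1, then 4-edge-connectivity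
yields 4 m <= 2 |E \ D|, a contradiction; so m = 1 and both classes are connected.
*)

Set Implicit Arguments.
Unset Strict Implicit.
Unset Printing Implicit Defensive.

(** * Walks and unordered pairs *)

Lemma connect_ind (T : finType) (e : rel T) (x : T) (P : T -> Prop) :
  P x -> (forall y z, connect e x y -> P y -> e y z -> P z) ->
  forall y, connect e x y -> P y.
Proof.
move=> Px step y /connectP[p + ->]; elim/last_ind: p => [|p z IHp] //=.
rewrite rcons_path last_rcons => /andP[ep elz].
by apply: step elz; [apply/connectP; exists p | apply: IHp].
Qed.

Lemma set2_inj (T : finType) (v w x y : T) :
  [set v; w] = [set x; y] -> (v = x /\ w = y) \/ (v = y /\ w = x).
Proof.
move=> /setP E.
have /set2P[] : v \in [set x; y] by rewrite -E set21.
- move=> vx; have /set2P[wx|->] : w \in [set x; y] by rewrite -E set22.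
    have /set2P[] : y \in [set v; w] by rewrite E set22.
      by move=> ->; left; subst.
    by move=> ->; left; subst.
  by left.
- move=> vy; have /set2P[->|wy] : w \in [set x; y] by rewrite -E set22.
    by right.
  have /set2P[] : x \in [set v; w] by rewrite E set21.
    by move=> ->; right; subst.
  by move=> ->; right; subst.
Qed.

(** * Connectivity by sets of edges *)

Section EdgeSets.
Variable T : finType.
Implicit Types (S A D E F Q : {set {set T}}) (e f : {set T}) (x y u v : T).

(* [[set x; x]] is a singleton, so a singleton in [S] gives a loop. *)
Definition erel S : rel T := [rel x y | [set x; y] \in S].

Lemma erel_csym S : connect_sym (erel S).
Proof. by apply: sym_connect_sym => x y; rewrite /erel /= [[set y; x]]setUC. Qed.

Definition spans S e := [forall x in e, forall y in e, connect (erel S) x y].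

Lemma spansE S x y : spans S [set x; y] = connect (erel S) x y.
Proof.
apply/forall_inP/idP => [sp | cxy u /set2P uxy].
  by move/forall_inP: (sp x (set21 x y)); apply; rewrite set22.
apply/forall_inP => v /set2P vxy.
by case: uxy vxy => -> [] ->; rewrite ?connect0 // erel_csym.
Qed.

Lemma connect_spans S S' x y :
  (forall e, e \in S -> spans S' e) ->
  connect (erel S) x y -> connect (erel S') x y.
Proof. by move=> sp; apply: connect_sub => u v /= /sp; rewrite spansE. Qed.

Lemma spans_trans S S' e :
  (forall f, f \in S -> spans S' f) -> spans S e -> spans S' e.
Proof.
move=> sp /forall_inP Se; apply/forall_inP => x xe; apply/forall_inP => y ye.
by apply: connect_spans sp _; move/forall_inP: (Se x xe); apply.
Qed.

Definition pairs S := forall e, e \in S -> exists x y, x != y /\ e = [set x; y].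

Lemma pairs_sub S S' : S \subset S' -> pairs S' -> pairs S.
Proof. by move=> /subsetP sub pS e /sub /pS. Qed.

Lemma mem_spans S e : pairs S -> e \in S -> spans S e.
Proof.
move=> pS eS; have [x [y [_ exy]]] := pS e eS.
by rewrite exy spansE connect1 // /erel /= -exy.
Qed.

Lemma spans_mono S S' e : S \subset S' -> spans S e -> spans S' e.
Proof.
move=> /subsetP sub /forall_inP Se; apply/forall_inP => x xe.
apply/forall_inP => y ye.
have /forall_inP/(_ y ye) := Se x xe.
by apply: connect_sub => u v /= /sub uv; apply: connect1.
Qed.

(** A walk that crosses the new edge repeatedly can be shortened, so at most one crossing, in either
    direction, is needed. *)
Lemma connectU1 S x y u v :
  connect (erel ([set x; y] |: S)) u v ->
  [\/ connect (erel S) u v,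
      connect (erel S) u x /\ connect (erel S) y v |
      connect (erel S) u y /\ connect (erel S) x v].
Proof.
move: v; apply: connect_ind => [|v w _ IH]; first by constructor 1.
rewrite /erel /= inE => /orP[/set1P /set2_inj | /(@connect1 _ (erel S)) vw]; last first.
  case: IH => [uv|[ux yv]|[uy xv]]; [constructor 1|constructor 2|constructor 3].
  - exact: connect_trans uv vw.
  - by split=> //; apply: connect_trans yv vw.
  - by split=> //; apply: connect_trans xv vw.
case=> -[? ?]; subst.
- by case: IH => [uv|[ux _]|[uy _]]; [constructor 2|constructor 2|constructor 1].
- by case: IH => [uv|[ux _]|[uy _]]; [constructor 3|constructor 1|constructor 3].
Qed.

(** * Edges on cycles *)

Definition free S := [set e in S | spans (S :\ e) e].

Lemma free_sub S : free S \subset S.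
Proof. by apply/subsetP => e; rewrite inE => /andP[]. Qed.

(* Every edge of a cycle through [e] is free; a cycle is [e] together with a
   minimal set [Q] joining its ends. *)
Lemma free_spans S e : pairs S -> e \in free S -> spans (free S :\ e) e.
Proof.
move=> pS; rewrite inE => /andP[eS]; have [u [v [_ E]]] := pS e eS.
rewrite {2}E spansE => cuv.
have [Q /minsetP[Quv Qmin] QS] :=
  @minset_exists _ (fun Q => connect (erel Q) u v) _ cuv.
suff sub : Q \subset free S :\ e by apply: spans_mono sub _; rewrite E spansE.
apply/subsetP => f fQ; have := subsetP QS f fQ; rewrite !inE => /andP[fe fS].
rewrite fe fS /=; have [x [y [_ F]]] := pS f fS.
have ncuv : ~~ connect (erel (Q :\ f)) u v.
  apply/negP => c; have /setP/(_ f) := Qmin _ c (subsetDl _ _).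
  by rewrite !inE eqxx fQ.
have QfS : Q :\ f \subset S :\ f.
  by rewrite setSD //; apply: subset_trans QS (subsetDl _ _).
have euv : connect (erel (S :\ f)) u v.
  by rewrite connect1 // /erel /= -E !inE eq_sym fe.
have mono a b : connect (erel (Q :\ f)) a b -> connect (erel (S :\ f)) a b.
  by rewrite -!spansE; apply: spans_mono.
(* [Q :\ f] no longer joins [u] to [v], so the walk crosses [f]; closing it up through [e] joins the
   ends of [f] without [f]. *)
have : connect (erel ([set x; y] |: (Q :\ f))) u v by rewrite -F setD1K.
rewrite {3}F spansE => /connectU1[c|[/mono ux /mono yv]|[/mono uy /mono xv]].
- by rewrite c in ncuv.
- rewrite erel_csym in ux; rewrite erel_csym in yv.
  exact: connect_trans ux (connect_trans euv yv).
- rewrite erel_csym in euv.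
  exact: connect_trans xv (connect_trans euv uy).
Qed.

(** * Counting components *)

Definition comp S := #|[set root (erel S) x | x : T]|.

(** Components of [S] lie within those of [S'], so the [S']-root of a vertex depends only on its
    [S]-root. *)
Lemma root_imset S S' :
  (forall e, e \in S -> spans S' e) ->
  [set root (erel S') x | x : T] =
  root (erel S') @: [set root (erel S) x | x : T].
Proof.
move=> sp; rewrite -imset_comp; apply: eq_imset => x /=.
apply/(rootP (erel_csym S')); apply: connect_spans sp _; exact: connect_root.
Qed.

Lemma leq_comp S S' : (forall e, e \in S -> spans S' e) -> comp S' <= comp S.
Proof. by move=> sp; rewrite /comp (root_imset sp) leq_imset_card. Qed.

(** Were the counts equal, sending [S]-roots to [S']-roots would be injective, yet it identifies the
    roots of the two ends of [e]. *)
Lemma ltn_comp S S' e : pairs S' -> S \subset S' ->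
  e \in S' -> ~~ spans S e -> comp S' < comp S.
Proof.
move=> pS' sub eS'; have [x [y [_ E]]] := pS' e eS'; rewrite E spansE => nc.
have sp f : f \in S -> spans S' f by move/(subsetP sub)/(mem_spans pS').
rewrite /comp (root_imset sp) ltn_neqAle leq_imset_card andbT.
apply: contra nc => /imset_injP inj.
rewrite -(root_connect (erel_csym S)); apply/eqP; apply: inj; rewrite ?imset_f //.
apply/(rootP (erel_csym S')).
have mono a b : connect (erel S) a b -> connect (erel S') a b.
  exact: connect_spans sp.
have /mono xr := connect_root (erel S) x; rewrite erel_csym in xr.
apply: connect_trans xr _; apply: connect_trans (mono _ _ (connect_root _ _)).
by rewrite connect1 // /erel /= -E.
Qed.

Lemma comp_free S e : pairs S -> e \in free S -> comp (S :\ e) <= comp S.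
Proof.
move=> pS eS; apply: leq_comp => f fS; have [->|fe] := eqVneq f e.
  by move: eS; rewrite inE => /andP[].
by apply: mem_spans; [apply: pairs_sub (subsetDl _ _) pS | rewrite !inE fe].
Qed.

(** The edges of [S] are bridges of [A] and stay bridges as others are deleted, so each deletion
    adds a component. *)
Lemma comp_bridges A S : pairs A -> S \subset A -> [disjoint S & free A] ->
  comp A + #|S| <= comp (A :\: S).
Proof.
move=> pA; have [n] := ubnP #|S|; elim: n S => // n IH S ltSn SA dis.
have [->|[e eS]] := set_0Vmem S; first by rewrite cards0 addn0 setD0.
have SeS : S :\ e \subset S by apply: subsetDl.
rewrite (cardsD1 e S) eS addnCA add1n; rewrite (cardsD1 e S) eS in ltSn.
have /leq_ltn_trans -> //: comp A + #|S :\ e| <= comp (A :\: (S :\ e)).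
  by apply: IH => //; [apply: subset_trans SeS SA | apply: disjointWl SeS dis].
have eA : e \in A by apply: subsetP eS.
apply: (@ltn_comp _ _ e).
- exact: pairs_sub (subsetDl _ _) pA.
- exact: setDS.
- by rewrite !inE eqxx eA.
- have : e \notin free A by rewrite (disjointFr dis).
  rewrite inE eA /=; apply: contra; apply: spans_mono; rewrite setDS //.
  by rewrite sub1set.
Qed.

(** * Optimal bipartitions and moves *)

Section Packing.
Variable E : {set {set T}}.
Hypothesis pE : pairs E.

Definition cost A := comp A + comp (E :\: A).

Definition optimal A :=
  A \subset E /\ forall A', A' \subset E -> cost A <= cost A'.

Lemma setDD1 A e : A \subset E -> e \in A -> E :\: (A :\ e) = e |: (E :\: A).
Proof.
move=> /subsetP AE eA; apply/setP => f; rewrite !inE negb_and negbK.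
by have [->|] := eqVneq f e; rewrite //= AE.
Qed.

Lemma setDDK A : A \subset E -> E :\: (E :\: A) = A.
Proof. by move=> AE; rewrite setDDr setDv set0U (setIidPr AE). Qed.

(** Otherwise moving [e] across would merge two components of the other class without splitting one
    of [A], lowering the cost. *)
Lemma optimal_spans A e : optimal A -> e \in free A -> spans (E :\: A) e.
Proof.
move=> [AE Amin] eA; apply: contraT => nsp.
have eA' : e \in A by apply: subsetP (free_sub A) e eA.
have AeE : A :\ e \subset E by apply: subset_trans (subsetDl _ _) AE.
have := Amin _ AeE; rewrite leqNgt => /negP[]; rewrite /cost -addnS.
apply: leq_add.
  exact: comp_free (pairs_sub AE pE) eA.
apply: (@ltn_comp _ _ e) => //.
- exact: pairs_sub (subsetDl _ _) pE.
- exact: setDS (subsetDl _ _).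
- by rewrite setDD1 // setU11.
Qed.

Lemma optimal_move A e : optimal A -> e \in free A -> optimal (A :\ e).
Proof.
move=> [AE Amin] eA.
have AeE : A :\ e \subset E by apply: subset_trans (subsetDl _ _) AE.
split=> // A' /Amin; apply: leq_trans; apply: leq_add.
  exact: comp_free (pairs_sub AE pE) eA.
apply: leq_comp => f fA.
apply: mem_spans; first exact: pairs_sub (subsetDl _ _) pE.
by apply: subsetP fA; apply: setDS (subsetDl _ _).
Qed.

Lemma free_move A e :
  optimal A -> e \in free A -> e \in free (E :\: (A :\ e)).
Proof.
move=> oA eA; have eA' : e \in A by apply: subsetP (free_sub A) e eA.
have eEA : e \notin E :\: A by rewrite inE eA'.
by rewrite setDD1 ?(proj1 oA) // inE setU11 setU1K // optimal_spans.
Qed.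

(* Moving a free edge from either side to the other is a composite of steps. *)
Definition step : rel {set {set T}} :=
  [rel A A' | (A' == E :\: A) || [exists e in free A, A' == A :\ e]].

Lemma stepC A : step A (E :\: A).
Proof. by rewrite /step /= eqxx. Qed.

Lemma stepD A e : e \in free A -> step A (A :\ e).
Proof. by move=> eA; apply/orP; right; apply/exists_inP; exists e. Qed.

Lemma optimalC A : optimal A -> optimal (E :\: A).
Proof.
move=> [AE Amin]; split=> [|A' /Amin]; first exact: subsetDl.
by rewrite /cost setDDK // addnC.
Qed.

Lemma optimal_step A A' : optimal A -> step A A' -> optimal A'.
Proof.
move=> oA /orP[/eqP->|/exists_inP[e eA /eqP->]]; first exact: optimalC.
exact: optimal_move.
Qed.

(** A move of [e] is undone by complementing, moving [e] back, as it is free there too, and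
    complementing again. *)
Lemma step_csym A A' : optimal A -> step A A' -> connect step A' A.
Proof.
move=> oA; have AE := proj1 oA.
have CC := setDDK AE.
move=> /orP[/eqP->|/exists_inP[e eA /eqP->]].
  by apply: connect1; rewrite -{2}CC stepC.
have eA' : e \in A by apply: subsetP (free_sub A) e eA.
apply: connect_trans (connect1 (stepC _)) _.
apply: connect_trans (connect1 (stepD (free_move oA eA))) _.
rewrite setDD1 // setU1K; last by rewrite inE eA'.
by apply: connect1; rewrite -{2}CC stepC.
Qed.

Lemma optimal_ex : exists A, optimal A.
Proof.
have [A AE Amin] := @arg_minnP _ set0 (fun A => A \subset E) cost (sub0set E).
by exists A.
Qed.

(** * The core of the reachable bipartitions *)

Section Reachable.
Variable A0 : {set {set T}}.
Hypothesis oA0 : optimal A0.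

Definition core := \bigcup_(A | connect step A0 A) free A.

Lemma reach_optimal A :
  connect step A0 A -> optimal A /\ connect step A A0.
Proof.
move: A; apply: connect_ind => [|A A' _ [oA cA] sA]; first by [].
split; first exact: optimal_step sA.
exact: connect_trans (step_csym oA sA) cA.
Qed.

Lemma free_core A : connect step A0 A -> free A \subset A :&: core.
Proof. by move=> cA; rewrite subsetI free_sub (bigcup_sup A). Qed.

Lemma reach_spans A e :
  connect step A0 A -> e \in core -> spans (A :&: core) e.
Proof.
move=> cA /bigcupP[A1 c1 eA1].
(* A step may swap the classes, so the induction carries both. *)
suff [] : spans (A :&: core) e /\ spans ((E :\: A) :&: core) e by [].
have [o1 c10] := reach_optimal c1.
have free_sp A2 d : connect step A0 A2 -> d \in free A2 ->
    spans (A2 :&: core :\ d) d.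
  move=> c2 dA2; have [o2 _] := reach_optimal c2.
  apply: spans_mono (free_spans (pairs_sub (proj1 o2) pE) dA2).
  exact: setSD (free_core c2).
(* Reachability is symmetric, so [A] is reached from [A1], where [e] is free. *)
move: A {cA} (connect_trans c10 cA).
apply: connect_ind => [|A A' c1A [spA spC] sAA'].
  (* In [A1] the rest of a cycle through [e] serves; the other class is treated likewise after
     moving [e] there. *)
  split; first exact: spans_mono (subsetDl _ _) (free_sp _ _ c1 eA1).
  have c1' : connect step A0 (E :\: (A1 :\ e)).
    apply: connect_trans c1 _; apply: connect_trans (connect1 (stepC _)).
    exact: connect1 (stepD eA1).
  have eA1' : e \in A1 by apply: subsetP (free_sub A1) e eA1.
  apply: spans_mono (free_sp _ _ c1' (free_move o1 eA1)).
  rewrite setDD1 ?(proj1 o1) // -setIDAC setU1K //.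
  by rewrite inE eA1'.
have cA := connect_trans c1 c1A; have [[AE _] _] := reach_optimal cA.
case/orP: sAA' => [/eqP->|/exists_inP[d dA /eqP->]].
  by rewrite setDDK.
split; last first.
  by apply: spans_mono spC; apply/setSI/setDS/subsetDl.
have sub : A :&: core :\ d \subset (A :\ d) :&: core by rewrite setIDAC.
(* A walk using [d] is rerouted along the rest of a cycle through [d], whose edges are free and
   hence in the core. *)
apply: spans_mono sub _; apply: spans_trans spA => f fA.
have [->|fd] := eqVneq f d; first exact: free_sp.
apply: mem_spans; last by rewrite in_setD1 fd.
apply: pairs_sub pE; apply: subset_trans (subsetDl _ _) _.
exact: subset_trans (subsetIl _ _) AE.
Qed.

(** Edges of [A] outside the core are bridges; deleting them leaves [A :&: core], which joins the
    ends of every core edge. *)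
Lemma reach_count A : connect step A0 A ->
  comp A + #|A :\: core| <= comp core.
Proof.
move=> cA; have [[AE _] _] := reach_optimal cA.
have /leq_trans -> //: comp A + #|A :\: core| <= comp (A :&: core).
  have -> : A :&: core = A :\: (A :\: core) by rewrite setDDr setDv set0U.
  apply: comp_bridges; first exact: pairs_sub AE pE.
    exact: subsetDl.
  rewrite disjoints_subset setDE; apply: subset_trans (subsetIr _ _) _.
  by rewrite setCS; apply: subset_trans (free_core cA) (subsetIr _ _).
by apply: leq_comp => e; apply: reach_spans.
Qed.

End Reachable.
End Packing.

Lemma comp_gt0 S x : 0 < comp S.
Proof. by apply/card_gt0P; exists (root (erel S) x); apply: imset_f. Qed.

Lemma comp_le1 S x y : comp S <= 1 -> connect (erel S) x y.
Proof.
move=> /card_le1_eqP c1; apply/(rootP (erel_csym S)).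
by apply: c1; apply: imset_f.
Qed.

(** * Parity correction and double counting *)

Definition inc S v := #|[set e in S | v \in e]|.

Lemma incD1 S e v : e \in S -> inc S v = (v \in e) + inc (S :\ e) v.
Proof.
move=> eS; rewrite /inc (cardsD1 e) inE eS; congr (_ + #|pred_of_set _|).
by apply/setP => f; rewrite !inE andbA.
Qed.

Definition toggle S e := if e \in S then S :\ e else e |: S.

Lemma odd_inc_toggle S e v :
  odd (inc (toggle S e) v) = odd (inc S v) (+) (v \in e).
Proof.
rewrite /toggle; case: ifPn => eS.
  by rewrite (incD1 v eS) oddD oddb addbAC addbb addFb.
by rewrite (incD1 v (setU11 e S)) setU1K // oddD oddb addbC.
Qed.

(** Toggling the edges of a walk flips the parity twice at each passage through an inner vertex and
    once at each end; edges of [A] are never touched. *)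
Lemma toggle_path A E F x y : A \subset F -> F \subset E -> pairs E ->
  connect (erel (E :\: A)) x y ->
  exists F', [/\ A \subset F', F' \subset E &
    forall v, odd (inc F' v) = odd (inc F v) (+) (v == x) (+) (v == y)].
Proof.
move=> AF FE pE; move: y; apply: connect_ind => [|y z _ [F' [AF' FE' IH]]].
  by exists F; split=> // v; rewrite -addbA addbb addbF.
rewrite /erel /= => yzB; have := yzB; rewrite inE => /andP[yzA yzE].
have yz : y != z.
  have [a [b [ab]]] := pE _ yzE.
  by case/set2_inj => -[-> ->] //; rewrite eq_sym.
exists (toggle F' [set y; z]); split.
- rewrite /toggle; case: ifP => _; first by rewrite subsetD1 AF'.
  exact: subset_trans AF' (subsetUr _ _).
- rewrite /toggle; case: ifP => _; first exact: subset_trans (subsetDl _ _) FE'.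
  by rewrite subUset sub1set yzE.
- move=> v; rewrite odd_inc_toggle IH !inE -!addbA; congr (_ (+) (_ (+) _)).
  by have [->|] := eqVneq v y; first by rewrite (negbTE yz).
Qed.

(** A vertex of even incidence is joined to the sink [x0] by a walk outside [A]; toggling it
    disturbs no other vertex of the list. *)
Lemma odd_inc_join A E (x0 : T) (s : seq T) : A \subset E -> pairs E ->
  (forall x y, connect (erel (E :\: A)) x y) -> x0 \notin s ->
  exists F, [/\ A \subset F, F \subset E & {in s, forall v, odd (inc F v)}].
Proof.
move=> AE pE conn; elim: s => [|x s IH]; first by exists A.
rewrite inE negb_or => /andP[x0x x0s]; have [F [AF FE oF]] := IH x0s.
case: (boolP (odd (inc F x))) => ox.
  by exists F; split=> // v; rewrite inE => /predU1P[->|/oF].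
have [F' [AF' FE' oF']] := toggle_path AF FE pE (conn x x0).
exists F'; split=> // v; rewrite inE oF'.
have [->|vx] := eqVneq v x; first by rewrite (negbTE ox) eq_sym (negbTE x0x).
move=> /= vs; rewrite oF // addbF; case: eqP => // vx0.
by rewrite -vx0 vs in x0s.
Qed.

Lemma double_count (I J : finType) (X : {set I}) (Y : {set J})
    (P : I -> J -> bool) :
  \sum_(i in X) #|[set j in Y | P i j]| = \sum_(j in Y) #|[set i in X | P i j]|.
Proof.
under eq_bigr do rewrite -sum1dep_card big_mkcondr.
rewrite exchange_big; apply: eq_bigr => j _.
by rewrite -sum1dep_card big_mkcondr.
Qed.

Lemma sum_inc S : pairs S -> \sum_v inc S v = #|S|.*2.
Proof.
move=> pS; have -> : \sum_v inc S v = \sum_(v in [set: T]) inc S v.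
  by apply: eq_bigl => v; rewrite inE.
rewrite double_count -muln2 -sum_nat_const; apply: eq_bigr => e /pS[x [y [xy ->]]].
(* The factor 2 is read as the size [(x != y).+1] of the pair. *)
rewrite -[2]/(true.+1) -xy -cards2; apply: eq_card => v.
by rewrite inE in_setT.
Qed.

End EdgeSets.

(** * Application to 4-edge-connected graphs *)

Section Graph.
Variables (T : finType) (G : sgraph T).

Lemma edgesE x y : ([set x; y] \in edges G) = G x y.
Proof.
apply/imset2P/idP => [[a b _]|xy]; last by exists x y; rewrite ?inE.
by rewrite inE /= => ab /set2_inj[] [-> ->] //; rewrite adj_sym.
Qed.

Lemma pairs_edges : pairs (edges G).
Proof.
move=> e /imset2P[x y _]; rewrite inE /= => xy ->; exists x, y; split=> //.
by apply: contraTneq xy => ->; rewrite adj_irr.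
Qed.

(** The counted set contains every edge leaving the component with root [r]. If it were smaller than
    4, deleting it would keep the graph connected, so that component would be everything. *)
Lemma comp_cut D (X := [set root (erel D) x | x : T]) r : D \subset edges G ->
  edge_connected 4 G -> 1 < comp D -> r \in X ->
  4 <= #|[set e in edges G :\: D | r \in root (erel D) @: e]|.
Proof.
move=> DE [_ conn] c1 rX; set C := [set _ in _ | _].
rewrite leqNgt; apply/negP => ltC.
have CE : C \subset edges G.
  by apply/subsetP => e; rewrite !inE => /andP[/andP[]].
have [_ {}conn] := conn _ CE ltC.
have /imsetP[x0 _ rx0] := rX.
suff all1 z : root (erel D) z = r.
  have : comp D <= #|[set r]|.
    by apply: subset_leq_card; apply/subsetP => _ /imsetP[z _ ->]; rewrite all1 set11.
  by rewrite cards1 leqNgt c1.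
move: z (conn x0 z); apply: connect_ind => [|y z _ ry] //=.
rewrite /del_adj /= -edgesE => /andP[yzE]; rewrite !inE yzE andbT negb_and negbK.
case/orP => [yzD|/negP[]].
  by rewrite -ry; apply/esym/(rootP (erel_csym D))/connect1.
by apply/imsetP; exists y; rewrite ?set21.
Qed.

Lemma connected_bipartition : edge_connected 4 G ->
  exists A : {set {set T}}, [/\ A \subset edges G, forall x y, connect (erel A) x y &
    forall x y, connect (erel (edges G :\: A)) x y].
Proof.
move=> ec; have pE := pairs_edges; set E := edges G in pE *.
have [A oA] := optimal_ex E; have AE := proj1 oA.
(* Complementation is a step, so both classes are measured against the same core. *)
have := reach_count pE oA (connect0 _ A).
have := reach_count pE oA (connect1 (stepC E A)).
set D := core E A => cB cA.
have DE : D \subset E.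
  apply/bigcupsP => A' /(reach_optimal pE oA)[[A'E _] _].
  exact: subset_trans (free_sub _) A'E.
have [c1|c1] := leqP (comp D) 1.
  exists A; split=> // x y; apply: comp_le1; apply: leq_trans c1.
    exact: leq_trans (leq_addr _ _) cA.
  exact: leq_trans (leq_addr _ _) cB.
have [x _] : exists x : T, x \in T by apply/card_gt0P; case: ec => /ltnW.
have := comp_gt0 A x; have := comp_gt0 (E :\: A) x.
have cE : #|E :\: D| = #|A :\: D| + #|(E :\: A) :\: D|.
  rewrite -(cardsID A); congr (_ + _); apply: eq_card => e; rewrite !inE.
    by case eA: (e \in A); rewrite ?andbF // (subsetP AE) ?andbT.
  by rewrite andbCA.
pose X := [set root (erel D) x | x : T].
pose cut r := [set e in E :\: D | r \in root (erel D) @: e].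
have le1 : \sum_(r in X) 4 <= \sum_(r in X) #|cut r|.
  by apply: leq_sum => r rX; apply: comp_cut.
(* An edge has two ends, so it meets at most two components. *)
have le2 : \sum_(r in X) #|cut r| <= \sum_(e in E :\: D) 2.
  rewrite double_count; apply: leq_sum => e.
  rewrite inE => /andP[_ /pE[a [b [ab ->]]]].
  apply: (@leq_trans #|root (erel D) @: [set a; b]|).
    by apply: subset_leq_card; apply/subsetP => r; rewrite inE => /andP[].
  by apply: leq_trans (leq_imset_card _ _) _; rewrite cards2 ab.
have := leq_trans le1 le2; rewrite !sum_nat_const -/(comp D).
(* Here [4 * comp D <= 2 * #|E :\: D|], while [cA] and [cB] add up to
   [#|E :\: D| + 2 <= 2 * comp D], as both classes have a component. *)
move: cA cB; rewrite -/E cE; lia.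
Qed.

(** Deleting the complement of [S] leaves the graph with edge set [S]; mapping [w] to [[set v; w]]
    matches neighbours of [v] with edges at [v]. *)
Lemma degree_inc (S : {set {set T}}) v :
  S \subset edges G -> degree (del_edges G (~: S)) v = inc S v.
Proof.
move=> SE; rewrite /degree /inc.
rewrite -(@card_in_imset _ _ (fun w => [set v; w])); last first.
  by move=> w w' _ _ /set2_inj[[_ ->] | [<- ->]].
apply: eq_card => e; rewrite inE; apply/imsetP/andP => [[w]|[eS ve]].
  by rewrite inE /= /del_adj /= inE negbK => /andP[_ wS] ->; rewrite set21.
have [a [b [ab E]]] := pairs_edges (subsetP SE e eS).
have [w Ew] : exists w, e = [set v; w].
  by move: ve; rewrite E => /set2P[] ->; [exists b|exists a]; rewrite // setUC.
exists w => //; rewrite inE /= /del_adj /= inE negbK -Ew eS andbT -edgesE -Ew.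
exact: subsetP eS.
Qed.
End Graph.

Theorem theorem2p2 (T : finType) (G : sgraph T) :
  edge_connected 4 G -> ~~ odd #|T| ->
  exists F : sgraph T, [/\ factor F G, connected_graph F & odd_graph F].
Proof.
move=> ec evT; have [A [AE cA cB]] := connected_bipartition ec.
have T0 : 0 < #|T| by case: ec => /ltnW.
have [x0 _] := card_gt0P T0.
have x0s : x0 \notin enum (predC1 x0) by rewrite mem_enum !inE eqxx.
have [F [AF FE oF]] := odd_inc_join AE (@pairs_edges _ G) cB x0s.
exists (del_edges G (~: F)); split.
- by move=> x y /andP[].
- split=> // x y; apply: connect_sub (cA x y) => u v uv; apply: connect1.
  by rewrite /= /del_adj /= inE negbK -edgesE (subsetP AE) // (subsetP AF).
have {}oF v : v != x0 -> odd (inc F v) by move=> vx; apply: oF; rewrite mem_enum.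
move=> v; rewrite degree_inc //; have [->|/oF //] := eqVneq v x0.
(* Handshake: the total is even, and the terms away from [x0] are odd and odd in number, so the term
   at [x0] is odd. *)
have := sum_inc (pairs_sub FE (@pairs_edges _ G)).
rewrite (bigD1 x0) //= => /(congr1 odd); rewrite oddD odd_double.
have -> : odd (\sum_(i | i != x0) inc F i) = odd (\sum_(i : T | i != x0) 1).
  rewrite !(big_morph odd oddD (erefl : odd 0 = false)).
  by apply: eq_bigr => i /oF ->.
rewrite sum1_card cardC1; case: #|T| T0 evT => //= n _.
by rewrite negbK => ->; rewrite addbT => /negbFE.
Qed.
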